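(* Let $\Omega=\Omega(u,v)$ be a solution in $E^4$ of the Betchov-Da Rios equation $\Omega_v=\Omega_u\times\Omega_{uu}\times\Omega_{uuu}$ whose $u$-parameter curves are unit speed, with ED$^2$-frame field $\{T,E,D,N\}$ and associated functions $\kappa,\sigma,\tau$ (notation and standing assumptions as in the context). The soliton surface $S:\Omega=\Omega(u,v)$ is semi-umbilic if and only if $a_{34}\,\sigma=\kappa^3\tau\sigma$ holds, where $$a_{34}=\frac1\kappa\Big(\big(\kappa\tau\sigma^2-4\kappa_u\tau_u-\kappa\tau_{uu}\big)\kappa-2\big(\kappa_u^2+\kappa\kappa_{uu}\big)\tau\Big).$$
   Context: $E^4$ is Euclidean 4-space with inner product $\langle\cdot,\cdot\rangle$, and $x\times y\times z$ is the usual alternating ternary vector product of $E^4$ (with a fixed sign convention, e.g. $\langle w,x\times y\times z\rangle=\det(w,x,y,z)$). Subscripts $u,v$ denote partial derivatives. All functions are assumed sufficiently smooth on an open domain of the $(u,v)$-plane. ED$^2$-frame field: for each $v$, the unit speed curve $u\mapsto\Omega(u,v)$ lies on an oriented hypersurface of $E^4$; $T=\Omega_u$ and $N(u,v)$ is the unit normal of the hypersurface at $\Omega(u,v)$. One is in the case where $\{N,T,\Omega_{uu}\}$ is linearly dependent; $E$ is the normalization of $\Omega_{uuu}-\langle\Omega_{uuu},N\rangle N-\langle\Omega_{uuu},T\rangle T$ (assumed nonzero), and $D=N\times T\times E$. Associated functions: $\kappa=\kappa_n=\langle T_u,N\rangle$, $\sigma=\kappa_g^2=\langle E_u,D\rangle$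 (the superscript in $\kappa_g^2$ is an index, not a power), $\tau=\tau_g^1=\langle E_u,N\rangle$. The frame satisfies $T_u=\kappa N$, $E_u=\sigma D+\tau N$, $D_u=-\sigma E$, $N_u=-\kappa T-\tau E$. Standing assumption: $\kappa$ and $\tau$ are nowhere zero. Gaussian torsion: $\{E,N\}$ is the orthonormal normal frame of $S$. Let $g_{11}=\langle\Omega_u,\Omega_u\rangle$, $g_{12}=\langle\Omega_u,\Omega_v\rangle$, $g_{22}=\langle\Omega_v,\Omega_v\rangle$, and $\mathcal W=\kappa^2\tau$ (so $\mathcal W^2=g_{11}g_{22}-g_{12}^2$). Let $c_{11}^1=\langle\Omega_{uu},E\rangle$, $c_{12}^1=\langle\Omega_{uv},E\rangle$, $c_{22}^1=\langle\Omega_{vv},E\rangle$, and let $c_{ij}^2$ be the same with $N$ in place of $E$. Then $$K_N=\frac{g_{11}(c_{12}^1c_{22}^2-c_{12}^2c_{22}^1)-g_{12}(c_{11}^1c_{22}^2-c_{11}^2c_{22}^1)+g_{22}(c_{11}^1c_{12}^2-c_{11}^2c_{12}^1)}{\mathcal W^3}.$$ A point $p$ is semi-umbilic if and only if $K_N(p)=0$, and a surface is semi-umbilic if all its points are semi-umbilic. *)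

(* Defs.v *)
From HB Require Import structures.
From mathcomp Require Import all_boot all_order all_algebra.
From mathcomp Require Import all_classical all_reals all_analysis.
Set Implicit Arguments.
Unset Strict Implicit.
Unset Printing Implicit Defensive.
Import Order.TTheory GRing.Theory Num.Theory.
Import numFieldNormedType.Exports.
Local Open Scope classical_set_scope.
Local Open Scope ring_scope.

Section EuclideanSpace.
Context {R : realType}.
Implicit Types w x y z : 'rV[R]_4.

(* The norm that the library puts on 'rV[R]_4 is the sup norm, which induces
   the Euclidean topology; lengths below are always computed with [elen]. *)
Definition dotE x y : R := \sum_(i < 4) x 0 i * y 0 i.

Definition elen x : R := Num.sqrt (dotE x x).

Definition det4 w x y z : R := \det (\matrix_(a < 4) [:: w; x; y; z]`_a).

(* The vector characterized by dotE w (cross3 x y z) = det4 w x y z. *)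
Definition cross3 x y z : 'rV[R]_4 := \row_i det4 (delta_mx 0 i) x y z.

End EuclideanSpace.

(* Functions of class C^k on an open set A, for finite-dimensional V. *)
Fixpoint class_C {R : realType} {V W : normedModType R} (k : nat)
    (A : set V) (f : V -> W) : Prop :=
  if k is k'.+1 then
    (forall p, A p -> differentiable f p) /\ (forall d, class_C k' A ('D_d f))
  else forall p, A p -> {for p, continuous f}.

Section Hypersurface.
Context {R : realType}.

Definition grad4 (F : 'rV[R]_4 -> R) (p : 'rV[R]_4) : 'rV[R]_4 :=
  \row_i 'D_(delta_mx 0 i) F p.

(* M is locally a regular level set, and the orientation is a continuous
   unit normal field nu along M. *)
Definition oriented_hypersurface (M : set 'rV[R]_4)
    (nu : 'rV[R]_4 -> 'rV[R]_4) : Prop :=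
  [/\ {within M, continuous nu},
      forall q, M q -> dotE (nu q) (nu q) = 1 &
      forall q, M q ->
        exists (A : set 'rV[R]_4) (F : 'rV[R]_4 -> R),
        [/\ open A, A q, class_C 1 A F,
            M `&` A = [set x | F x = 0] `&` A &
            forall x, (M `&` A) x ->
              grad4 F x != 0 /\ exists c : R, grad4 F x = c *: nu x]].

End Hypersurface.

Section SolitonSurface.
Context {R : realType}.
Local Notation plane := (R * R)%type.
Local Notation E4 := 'rV[R]_4.

Definition du {W : normedModType R} (f : plane -> W) : plane -> W :=
  'D_((1, 0) : plane) f.
Definition dv {W : normedModType R} (f : plane -> W) : plane -> W :=
  'D_((0, 1) : plane) f.

Definition betchov_da_rios (U : set plane) (Om : plane -> E4) : Prop :=
  forall p, U p ->
    dv Om p = cross3 (du Om p) (du (du Om) p) (du (du (du Om)) p).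

Definition unit_speed (U : set plane) (Om : plane -> E4) : Prop :=
  forall p, U p -> dotE (du Om p) (du Om p) = 1.

Definition residual (Om T N : plane -> E4) (p : plane) : E4 :=
  let w := du (du (du Om)) p in
  w - dotE w (N p) *: N p - dotE w (T p) *: T p.

Record ED2_frame_field (U : set plane) (Om T E D N : plane -> E4) : Prop := {
  ED2_hypersurface : forall v : R,
    exists (M : set E4) (nu : E4 -> E4),
      oriented_hypersurface M nu /\
      forall u : R, U (u, v) -> M (Om (u, v)) /\ N (u, v) = nu (Om (u, v));
  ED2_T : forall p, U p -> T p = du Om p;
  ED2_dependent : forall p, U p -> ~~ free [:: N p; T p; du (du Om) p];
  ED2_residual : forall p, U p -> residual Om T N p != 0;
  ED2_E : forall p, U p ->
    E p = (elen (residual Om T N p))^-1 *: residual Om T N p;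
  ED2_D : forall p, U p -> D p = cross3 (N p) (T p) (E p)
}.

Definition kappa (T N : plane -> E4) (p : plane) : R := dotE (du T p) (N p).
Definition sigma (E D : plane -> E4) (p : plane) : R := dotE (du E p) (D p).
Definition tau (E N : plane -> E4) (p : plane) : R := dotE (du E p) (N p).

Definition gaussian_torsion (Om n1 n2 : plane -> E4) (W : plane -> R)
    (p : plane) : R :=
  let g11 := dotE (du Om p) (du Om p) in
  let g12 := dotE (du Om p) (dv Om p) in
  let g22 := dotE (dv Om p) (dv Om p) in
  let c11 (n : plane -> E4) := dotE (du (du Om) p) (n p) in
  let c12 (n : plane -> E4) := dotE (dv (du Om) p) (n p) in
  let c22 (n : plane -> E4) := dotE (dv (dv Om) p) (n p) in
  (g11 * (c12 n1 * c22 n2 - c12 n2 * c22 n1)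
   - g12 * (c11 n1 * c22 n2 - c11 n2 * c22 n1)
   + g22 * (c11 n1 * c12 n2 - c11 n2 * c12 n1)) / W p ^+ 3.

(* The area density sqrt (g11 g22 - g12^2), up to sign. *)
Definition soliton_W (T E N : plane -> E4) (p : plane) : R :=
  kappa T N p ^+ 2 * tau E N p.

Definition semi_umbilic_at (Om T E N : plane -> E4) (p : plane) : Prop :=
  gaussian_torsion Om E N (soliton_W T E N) p = 0.

Definition semi_umbilic (U : set plane) (Om T E N : plane -> E4) : Prop :=
  forall p, U p -> semi_umbilic_at Om T E N p.

Definition a34 (ka si ta : plane -> R) (p : plane) : R :=
  (ka p)^-1 *
  ((ka p * ta p * si p ^+ 2 - 4 * du ka p * du ta p - ka p * du (du ta) p)
     * ka p
   - 2 * (du ka p ^+ 2 + ka p * du (du ka) p) * ta p).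

End SolitonSurface.

(* Main.v *)
Require Import Defs.
From HB Require Import structures.
From mathcomp Require Import all_boot all_order all_algebra.
From mathcomp Require Import all_classical all_reals all_analysis.
From mathcomp Require Import ring.
Import Order.TTheory GRing.Theory Num.Theory.
Import numFieldNormedType.Exports.
Local Open Scope classical_set_scope.
Local Open Scope ring_scope.

(* On U one has Om_uu = kappa N and Om_uuu = -kappa tau E modulo N and T, so
   the Betchov-Da Rios equation reads Om_v = W D with W = kappa^2 tau. Hence
   g11 = 1, g12 = 0, g22 = W^2, c11 = (0, kappa) and c12 = (-W sigma, 0), so
   that up to a nonzero factor the Gaussian torsion is
   sigma (c22^2 - kappa W^2), where c22^2 is the N-component of Om_vv.
   Differentiating <Om_v, N> = 0 and Om_uu = kappa N along v gives
     kappa c22^2 = -W <Om_uuv, D> = -W <(W D)_uu, D> = -W (W_uu - sigma^2 W),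
   where the second step exchanges partial derivatives twice, and
   W_uu - sigma^2 W = -kappa a34 by expanding W_uu. *)

(** * Symmetry of second directional derivatives *)

(** Both derivatives are limits of the same difference quotient [q], so a directional derivative
    becomes one of a real variable. *)
Lemma is_derive_line {R : realType} {V W : normedModType R} {f : V -> W}
    {x v : V} {s : R} {l : W} :
  is_derive (s *: v + x) v f l ->
  is_derive s 1 (fun t : R => f (t *: v + x)) l.
Proof.
pose q (h : R) := h^-1 *: (f (h *: v + (s *: v + x)) - f (s *: v + x)).
have E : q = (fun h : R => h^-1 *:
    (((fun t : R => f (t *: v + x)) \o shift s) (h *: 1) - f (s *: v + x))).
  by apply/funext => h; rewrite /q /= addrA -scalerDl [_%:A]mulr1.
case; rewrite /derivable /derive -[X in cvg (X @ _)]/q => cq lq.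
by split; rewrite /derivable /derive -E.
Qed.

Lemma is_derive_translation {R : realType} {V W : normedModType R} {f : V -> W}
    {x y v : V} {l : W} :
  is_derive (y + x) v f l -> is_derive x v (fun z => f (y + z)) l.
Proof.
pose q (h : R) := h^-1 *: (f (h *: v + (y + x)) - f (y + x)).
have E : q = (fun h : R => h^-1 *:
    (((fun z => f (y + z)) \o shift x) (h *: v) - f (y + x))).
  by apply/funext => h; rewrite /q /= addrCA.
case; rewrite /derivable /derive -[X in cvg (X @ _)]/q => cq lq.
by split; rewrite /derivable /derive -E.
Qed.

Lemma directional_MVT {R : realType} {V : normedModType R} {f f' : V -> R}
    {x v : V} {h : R} : 0 < h ->
  (forall s : R, s \in `[0, h] ->
    is_derive (s *: v + x) v f (f' (s *: v + x))) ->
  exists2 s, s \in `[0, h] & f (h *: v + x) - f x = h * f' (s *: v + x).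
Proof.
move=> h0 df.
have dg (s : R) : s \in `[0, h] ->
    is_derive s 1 (fun t : R => f (t *: v + x)) (f' (s *: v + x)).
  by move=> sh; apply: is_derive_line; exact: df.
have dgoo (s : R) : s \in `]0, h[ ->
    is_derive s 1 (fun t : R => f (t *: v + x)) (f' (s *: v + x)).
  by move=> sI; apply: dg; exact: subset_itv_oo_cc sI.
have gc : {within `[0, h], continuous (fun t : R => f (t *: v + x))}.
  apply: derivable_within_continuous => s sI.
  by have [] := dg s sI.
have [c cI] := MVT h0 dgoo gc.
rewrite scale0r add0r subr0 mulrC => E; exists c => //.
exact: subset_itv_oo_cc cI.
Qed.

(** Two mean values: first along [d] for the increment y |-> f (h e + y) - f y, then along [e] for
    [fd]. *)
Lemma second_difference {R : realType} {V : normedModType R}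
    {f fd fde : V -> R} {x d e : V} {h : R} : 0 < h ->
  (forall s t : R, s \in `[0, h] -> t \in `[0, h] ->
    let y := s *: d + (t *: e + x) in
    is_derive y d f (fd y) /\ is_derive y e fd (fde y)) ->
  exists s t : R, [/\ s \in `[0, h], t \in `[0, h] &
    f (h *: d + (h *: e + x)) - f (h *: d + x) - f (h *: e + x) + f x =
    h * (h * fde (s *: d + (t *: e + x)))].
Proof.
move=> h0 df.
have h0I : 0 \in `[0, h] by rewrite in_itv /= lexx ltW.
have hhI : h \in `[0, h] by rewrite in_itv /= lexx ltW.
have [s sI E1] : exists2 s, s \in `[0, h] &
    (f (h *: e + (h *: d + x)) - f (h *: d + x)) - (f (h *: e + x) - f x) =
    h * (fd (h *: e + (s *: d + x)) - fd (s *: d + x)).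
  apply: (@directional_MVT _ _ (fun y => f (h *: e + y) - f y)
    (fun y => fd (h *: e + y) - fd y)) => // s sI.
  apply: is_deriveB.
    by apply: is_derive_translation; rewrite addrCA; have [] := df s h sI hhI.
  by have [] := df s 0 sI h0I; rewrite scale0r add0r.
have [t tI E2] : exists2 t, t \in `[0, h] &
    fd (h *: e + (s *: d + x)) - fd (s *: d + x) =
    h * fde (t *: e + (s *: d + x)).
  apply: directional_MVT => // t tI.
  by rewrite addrCA; have [] := df s t sI tI.
exists s, t; split => //.
rewrite [s *: d + _]addrCA -E2 -E1 [h *: e + (_ + _)]addrCA; ring.
Qed.

Lemma cvg_line {R : realType} {V : normedModType R} (x v : V) :
  (fun h : R => h *: v + x) @ (0 : R) --> x.
Proof.
rewrite -[X in _ --> X]add0r -(scale0r v).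
apply: cvgD; last exact: cvg_cst.
by apply: cvgZr_tmp; exact: cvg_id.
Qed.

Lemma nbhs_parallelogram {R : realType} {V : normedModType R} {P : set V}
    {x : V} (d e : V) : nbhs x P ->
  exists2 h : R, 0 < h & forall s t : R,
    s \in `[0, h] -> t \in `[0, h] -> P (s *: d + (t *: e + x)).
Proof.
have cg : (fun p : R * R => p.1 *: d + (p.2 *: e + x)) @ ((0, 0) : R * R) --> x.
  rewrite -[X in _ --> X]add0r -{1}(scale0r d).
  rewrite -[X in _ --> _ + X]add0r -(scale0r e).
  apply: cvgD; first by apply: cvgZr_tmp; exact: cvg_fst.
  apply: cvgD; last exact: cvg_cst.
  by apply: cvgZr_tmp; exact: cvg_snd.
(* Halving [k] turns the closed bounds on [s] and [t] into the strict bounds of the ball. *)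
move=> /cg /nbhs_ballP[k /= k0 kn]; exists (k / 2); first by rewrite divr_gt0.
move=> s t; rewrite !in_itv /= => /andP[s0 sk] /andP[t0 tk].
apply: (kn (s, t)); split; rewrite /= /ball /= sub0r normrN ger0_norm//.
- by rewrite (le_lt_trans sk)// ltr_pdivrMr// ltr_pMr// ltr1n.
- by rewrite (le_lt_trans tk)// ltr_pdivrMr// ltr_pMr// ltr1n.
Qed.

(** The second difference over a small parallelogram is symmetric in [d] and [e], so [fde] and [fed]
    agree at two points near [x]. By continuity each value is within r/2 of its value at [x], for
    any r > 0. *)
Lemma schwarz {R : realType} {V : normedModType R} {A : set V}
    {f fd fe fde fed : V -> R} {d e x : V} : open A -> A x ->
  (forall y, A y -> is_derive y d f (fd y)) ->
  (forall y, A y -> is_derive y e f (fe y)) ->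
  (forall y, A y -> is_derive y e fd (fde y)) ->
  (forall y, A y -> is_derive y d fe (fed y)) ->
  {for x, continuous fde} -> {for x, continuous fed} -> fde x = fed x.
Proof.
move=> oA Ax dfd dfe dfde dfed cde ced.
apply/eqP; rewrite -subr_eq0 -normr_le0; apply/ler_addgt0Pl => r r0.
rewrite addr0.
have r20 : 0 < r / 2 by rewrite divr_gt0.
have nA : nbhs x A by exact: open_nbhs_nbhs.
move/cvgrPdist_le : cde => /(_ _ r20) n1.
move/cvgrPdist_le : ced => /(_ _ r20) n2.
have [h h0 hn] := nbhs_parallelogram d e (filterI nA (filterI n1 n2)).
have D1 (s t : R) : s \in `[0, h] -> t \in `[0, h] ->
    let y := s *: d + (t *: e + x) in
    is_derive y d f (fd y) /\ is_derive y e fd (fde y).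
  by move=> sI tI; have [Ay _] := hn s t sI tI; split; [exact: dfd|exact: dfde].
have D2 (s t : R) : s \in `[0, h] -> t \in `[0, h] ->
    let y := s *: e + (t *: d + x) in
    is_derive y e f (fe y) /\ is_derive y d fe (fed y).
  move=> sI tI; have [+ _] := hn t s tI sI; rewrite addrCA => Ay.
  by split; [exact: dfe|exact: dfed].
have [s [t [sI tI E1]]] := second_difference h0 D1.
have [s' [t' [sI' tI' E2]]] := second_difference h0 D2.
have E : fde (s *: d + (t *: e + x)) = fed (t' *: d + (s' *: e + x)).
  have hN0 := lt0r_neq0 h0.
  apply: (mulfI hN0); apply: (mulfI hN0).
  rewrite [t' *: d + _]addrCA -E1 -E2 [h *: e + (h *: d + x)]addrCA.
  ring.
have [_ [b1 _]] := hn _ _ sI tI; have [_ [_ b2]] := hn _ _ tI' sI'.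
rewrite (splitr r) (le_trans _ (lerD b1 b2))// [X in _ <= _ + X]distrC E.
by rewrite (le_trans _ (ler_normD _ _))// addrA subrK.
Qed.


(** * The ternary vector product *)

(** Entries are indexed by [nat], so that the indices compute to numerals after expansion and [ring]
    recognizes equal entries. *)
Lemma det3_nat (R : comRingType) (a : nat -> nat -> R) :
  \det (\matrix_(i < 3, j < 3) a i j) =
    a 0 0 * (a 1 1 * a 2 2 - a 1 2 * a 2 1)
  - a 0 1 * (a 1 0 * a 2 2 - a 1 2 * a 2 0)
  + a 0 2 * (a 1 0 * a 2 1 - a 1 1 * a 2 0).
Proof.
rewrite (expand_det_row _ 0) !big_ord_recl big_ord0 /cofactor.
rewrite !(expand_det_row _ 0) !big_ord_recl !big_ord0 /cofactor !det_mx11 !mxE.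
by rewrite /= /bump /=; ring.
Qed.

Lemma det4_nat (R : comRingType) (a : nat -> nat -> R) :
  let m i j k :=
    a 1 i * (a 2 j * a 3 k - a 2 k * a 3 j)
  - a 1 j * (a 2 i * a 3 k - a 2 k * a 3 i)
  + a 1 k * (a 2 i * a 3 j - a 2 j * a 3 i) in
  \det (\matrix_(i < 4, j < 4) a i j) =
    a 0 0 * m 1 2 3 - a 0 1 * m 0 2 3 + a 0 2 * m 0 1 3 - a 0 3 * m 0 1 2.
Proof.
(* [bump j] skips column [j]: [s j] lists the entries left after deleting row 0 and column [j]. *)
pose s j i k := a i.+1 (bump j k).
have E (j : 'I_4) : \det (row' 0 (col' j (\matrix_(i < 4, k < 4) a i k))) =
    s j 0 0 * (s j 1 1 * s j 2 2 - s j 1 2 * s j 2 1)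
  - s j 0 1 * (s j 1 0 * s j 2 2 - s j 1 2 * s j 2 0)
  + s j 0 2 * (s j 1 0 * s j 2 1 - s j 1 1 * s j 2 0).
  by rewrite -det3_nat; congr (\det _); apply/matrixP => i k; rewrite !mxE.
rewrite (expand_det_row _ 0) !big_ord_recl big_ord0 /cofactor.
by rewrite !E !mxE /s /= /bump /=; ring.
Qed.

Section VectorProduct.
Context {R : realType}.
Implicit Types (w x y z : 'rV[R]_4) (a b c d : nat -> R).

Lemma rv4_nat x : exists a, x = \row_i a i.
Proof.
exists (fun k => x 0 (inord k)).
by apply/rowP => i; rewrite mxE inord_val.
Qed.

Lemma dotE_nat a b :
  dotE (\row_i a i) (\row_i b i) =
    a 0 * b 0 + a 1 * b 1 + a 2 * b 2 + a 3 * b 3.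
Proof.
by rewrite /dotE !big_ord_recl big_ord0 !mxE /= /bump /=; ring.
Qed.

Lemma det4E a b c d :
  det4 (\row_i a i) (\row_i b i) (\row_i c i) (\row_i d i) =
  \det (\matrix_(i < 4, j < 4)
    (fun i j : nat => nth 0 [:: a; b; c; d] i j) i j).
Proof.
rewrite /det4; congr (\det _); apply/matrixP => i j; rewrite !mxE.
by case: i => -[|[|[|[|//]]]] ? /=; rewrite mxE.
Qed.

(** These are the cofactors of the first row of a 4 x 4 determinant whose other rows are [a], [b],
    [c]. *)
Definition cross_nat a b c (k : nat) : R :=
  let m i j k :=
    a i * (b j * c k - b k * c j)
  - a j * (b i * c k - b k * c i)
  + a k * (b i * c j - b j * c i) in
  nth 0 [:: m 1 2 3; - m 0 2 3; m 0 1 3; - m 0 1 2] k.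

Lemma cross3_nat a b c :
  cross3 (\row_i a i) (\row_i b i) (\row_i c i) = \row_i cross_nat a b c i.
Proof.
apply/rowP => i; rewrite !mxE.
pose e k : R := (k == i :> nat)%:R.
have -> : delta_mx 0 i = \row_(j < 4) e j by apply/rowP => j; rewrite !mxE.
rewrite det4E det4_nat {}/e.
by case: i => -[|[|[|[|//]]]] ? /=; rewrite /cross_nat /=; ring.
Qed.

Lemma dotC x y : dotE x y = dotE y x.
Proof. by apply: eq_bigr => i _; rewrite mulrC. Qed.

Lemma dotDl x y z : dotE (x + y) z = dotE x z + dotE y z.
Proof. by rewrite -big_split; apply: eq_bigr => i _; rewrite mxE mulrDl. Qed.

Lemma dotZl (k : R) x y : dotE (k *: x) y = k * dotE x y.
Proof. by rewrite mulr_sumr; apply: eq_bigr => i _; rewrite mxE mulrA. Qed.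

Lemma dotDr x y z : dotE x (y + z) = dotE x y + dotE x z.
Proof. by rewrite dotC dotDl !(dotC _ x). Qed.

Lemma dotZr (k : R) x y : dotE x (k *: y) = k * dotE x y.
Proof. by rewrite dotC dotZl dotC. Qed.

Lemma dot_cross3_id x y z :
  [/\ dotE x (cross3 x y z) = 0, dotE y (cross3 x y z) = 0
     & dotE z (cross3 x y z) = 0].
Proof.
have [b ->] := rv4_nat x; have [c ->] := rv4_nat y; have [d ->] := rv4_nat z.
by rewrite cross3_nat !dotE_nat /cross_nat /=; split; ring.
Qed.

(** The right-hand side is the Gram determinant of [x], [y], [z], expanded along its first row. *)
Lemma cross3_norm x y z : let g := dotE in
  g (cross3 x y z) (cross3 x y z) =
    g x x * (g y y * g z z - g y z ^+ 2)
  - g x y * (g x y * g z z - g x z * g y z)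
  + g x z * (g x y * g y z - g x z * g y y).
Proof.
move=> /=.
have [b ->] := rv4_nat x; have [c ->] := rv4_nat y; have [d ->] := rv4_nat z.
by rewrite cross3_nat !dotE_nat /cross_nat /=; ring.
Qed.

(** The terms in [m] and [n] repeat an argument and vanish; the sign comes from swapping the first
    two arguments. With x = T, y = N, z = E this is the right-hand side of the Betchov-Da Rios
    equation in terms of D. *)
Lemma cross3_combination x y z (k l m n : R) :
  cross3 x (k *: y) (l *: z + m *: y + n *: x) = - (k * l) *: cross3 y x z.
Proof.
have [b ->] := rv4_nat x; have [c ->] := rv4_nat y; have [d ->] := rv4_nat z.
pose c' i := k * c i; pose e i := l * d i + m * c i + n * b i.
have -> : k *: \row_i c i = \row_(i < 4) c' i by apply/rowP => i; rewrite !mxE.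
have -> : l *: \row_i d i + m *: \row_i c i + n *: \row_i b i =
    \row_(i < 4) e i by apply/rowP => i; rewrite !mxE.
rewrite !cross3_nat; apply/rowP => i; rewrite !mxE.
by case: i => -[|[|[|[|//]]]] ? /=; rewrite /cross_nat /c' /e /=; ring.
Qed.

End VectorProduct.


(** The matrix [M] with the frame as rows satisfies M M^T = 1, hence M^T M = 1 as it is square, and
    passing to frame coordinates x M^T preserves inner products. *)
Lemma parseval4 {R : realType} {N T E D : 'rV[R]_4} (x y : 'rV[R]_4) :
  let g := dotE in
  g N N = 1 -> g T T = 1 -> g E E = 1 -> g D D = 1 ->
  g N T = 0 -> g N E = 0 -> g N D = 0 -> g T E = 0 -> g T D = 0 -> g E D = 0 ->
  g x y = g x N * g y N + g x T * g y T + g x E * g y E + g x D * g y D.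
Proof.
move=> /= NN TT EE DD NT NE ND TE TD ED.
pose e (i : 'I_4) := [:: N; T; E; D]`_i.
have eP i j : dotE (e i) (e j) = (i == j)%:R.
  case: i j => -[|[|[|[|//]]]] ? -[[|[|[|[|//]]]] ?] /=;
    by rewrite /e /= ?(dotC T N) ?(dotC E N) ?(dotC D N) ?(dotC E T)
               ?(dotC D T) ?(dotC D E).
pose M : 'M[R]_4 := \matrix_(i, j) e i 0 j.
have MM : M *m M^T = 1%:M.
  apply/matrixP => i j; rewrite !mxE -eP.
  by apply: eq_bigr => k _; rewrite !mxE.
have dotM (z w : 'rV[R]_4) : dotE z w = (z *m w^T) 0 0.
  by rewrite mxE; apply: eq_bigr => k _; rewrite mxE.
have xe (z : 'rV[R]_4) i : (z *m M^T) 0 i = dotE z (e i).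
  by rewrite mxE; apply: eq_bigr => k _; rewrite !mxE.
have -> : dotE x y = dotE (x *m M^T) (y *m M^T).
  rewrite [RHS]dotM trmx_mul trmxK mulmxA -[_ *m M]mulmxA (mulmx1C MM) mulmx1.
  by rewrite dotM.
rewrite {1}/dotE !big_ord_recl big_ord0 !xe /e /=; ring.
Qed.

(** * Calculus of vector-valued functions *)

Lemma is_derive_rV {R : realType} {V : normedModType R} {n : nat}
    {F : V -> 'rV[R]_n} {p d : V} {l : 'rV[R]_n} :
  is_derive p d F l <-> forall i, is_derive p d (fun q => F q 0 i) (l 0 i).
Proof.
split=> [[dF <-] i|dF].
  split; first by move/derivable_mxP : dF.
  by rewrite derive_mx// mxE.
have dF' : derivable F p d.
  apply/derivable_mxP => i j; rewrite (ord1 i).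
  by have [] := dF j.
split => //; rewrite derive_mx//; apply/rowP => i; rewrite mxE.
by have [_ <-] := dF i.
Qed.

Lemma is_derive_dotE {R : realType} {V : normedModType R}
    {F G : V -> 'rV[R]_4} {p d : V} {F' G' : 'rV[R]_4} :
  is_derive p d F F' -> is_derive p d G G' ->
  is_derive p d (fun q => dotE (F q) (G q)) (dotE F' (G p) + dotE (F p) G').
Proof.
move=> /is_derive_rV dF /is_derive_rV dG.
have -> : (fun q => dotE (F q) (G q)) =
    \sum_(i < 4) ((fun q => F q 0 i) * (fun q => G q 0 i)).
  by apply/funext => q; rewrite fct_sumE.
rewrite /dotE -big_split /=; apply: is_derive_sum => i.
by apply: is_derive_eq; rewrite addrC [_ *: F' 0 i]mulrC.
Qed.

Lemma derivable_cross3 {R : realType} {V : normedModType R}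
    {F G H : V -> 'rV[R]_4} {p d : V} :
  derivable F p d -> derivable G p d -> derivable H p d ->
  derivable (fun q => cross3 (F q) (G q) (H q)) p d.
Proof.
move=> /derivable_mxP dF /derivable_mxP dG /derivable_mxP dH.
apply/derivable_mxP => i0 m; rewrite (ord1 i0).
pose c (K : V -> 'rV[R]_4) q (k : nat) := K q 0 (inord k).
have cE K q : K q = \row_k c K q k.
  by apply/rowP => k; rewrite mxE /c inord_val.
under eq_fun do rewrite (cE F) (cE G) (cE H) cross3_nat mxE.
(* Every coordinate of the product is such a minor up to sign. *)
have D (i j k : nat) :
    let f i := c F ^~ i in let g i := c G ^~ i in let h i := c H ^~ i in
    derivable (f i * (g j * h k - g k * h j) - f j * (g i * h k - g k * h i)
      + f k * (g i * h j - g j * h i)) p d.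
  have f n : derivable (c F ^~ n) p d by exact: dF.
  have g n : derivable (c G ^~ n) p d by exact: dG.
  have h n : derivable (c H ^~ n) p d by exact: dH.
  move=> /=.
  apply: derivableD; [apply: derivableB|]; (apply: derivableM; first exact: f);
    by apply: derivableB; apply: derivableM;
       [exact: g|exact: h|exact: g|exact: h].
case: m => -[|[|[|[|//]]]] ? /=; rewrite /cross_nat /=.
- exact: (D 1 2 3).
- exact: (derivableN (D 0 2 3)).
- exact: (D 0 1 3).
- exact: (derivableN (D 0 1 2)).
Qed.

Lemma is_derive_open {R : realType} {V W : normedModType R} {A : set V}
    {f g : V -> W} {p d : V} {l : W} : open A -> A p ->
  (forall q, A q -> f q = g q) -> is_derive p d f l -> is_derive p d g l.
Proof.
move=> oA Ap fg; apply: near_eq_is_derive.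
by apply: filterS fg _; exact: open_nbhs_nbhs.
Qed.


Lemma class_CW {R : realType} {V W : normedModType R} (k : nat) {A : set V}
    {f : V -> W} : class_C k.+1 A f -> class_C k A f.
Proof.
elim: k f => [|k IH] f [df Df].
  by move=> p /df /differentiable_continuous.
by split => // d; exact: IH.
Qed.

Lemma class_C1_is_derive {R : realType} {V W : normedModType R} {k : nat}
    {A : set V} {f : V -> W} {p : V} (d : V) :
  class_C k.+1 A f -> A p -> is_derive p d f ('D_d f p).
Proof. by move=> [df _] Ap; split => //; apply: diff_derivable; exact: df. Qed.

(** [schwarz] is applied to each coordinate; class C^2 makes both mixed derivatives continuous. *)
Lemma class_C_schwarz {R : realType} {V : normedModType R} {n : nat}
    {A : set V} {F : V -> 'rV[R]_n} {p : V} (d e : V) : open A -> A p ->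
  class_C 2 A F -> 'D_e ('D_d F) p = 'D_d ('D_e F) p.
Proof.
move=> oA Ap CF.
have DF v : class_C 1 A ('D_v F) by have [_ /(_ v)] := CF.
have cont d1 d2 i : {for p, continuous (fun q => 'D_d2 ('D_d1 F) q 0 i)}.
  have [_ /(_ d2 p Ap) c] := DF d1.
  apply: (continuous_comp (g := fun M : 'rV[R]_n => M 0 i)) => //.
  exact: coord_continuous.
have dcoord k (G : V -> 'rV[R]_n) v i y : class_C k.+1 A G -> A y ->
    is_derive y v (fun q => G q 0 i) ('D_v G y 0 i).
  by move=> CG Ay; have /is_derive_rV := class_C1_is_derive v CG Ay.
apply/rowP => i.
exact: (schwarz oA Ap
  (fun y => dcoord _ _ d i y CF) (fun y => dcoord _ _ e i y CF)
  (fun y => dcoord 0 _ e i y (DF d)) (fun y => dcoord 0 _ d i y (DF e))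
  (cont d e i) (cont e d i)).
Qed.

Lemma class_C_du_dv {R : realType} {n : nat} {U : set (R * R)}
    {F : R * R -> 'rV[R]_n} {p : R * R} : open U -> U p ->
  class_C 2 U F -> dv (du F) p = du (dv F) p.
Proof. exact: class_C_schwarz. Qed.

(** * Hypersurface normals and linear dependence *)

Lemma derive_grad4 {R : realType} (F : 'rV[R]_4 -> R) (x w : 'rV[R]_4) :
  differentiable F x -> 'd F x w = dotE (grad4 F x) w.
Proof.
move=> dF; rewrite [in LHS](row_sum_delta w) linear_sum; apply: eq_bigr => i _.
by rewrite linearZ /= mxE deriveE// mulrC.
Qed.

(** A local equation F of M vanishes along Om (h d + p) for small h, so the chain rule gives <grad
    F, D_d Om> = 0. Here grad F = c nu, and c is nonzero because grad F is. *)
Lemma normal_tangent {R : realType} {V : normedModType R} {M : set 'rV[R]_4}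
    {nu : 'rV[R]_4 -> 'rV[R]_4} {Om : V -> 'rV[R]_4} {p d : V} :
  oriented_hypersurface M nu -> differentiable Om p ->
  (\forall h \near (0 : R), M (Om (h *: d + p))) ->
  dotE (nu (Om p)) ('D_d Om p) = 0.
Proof.
move=> [_ _ +] dOm nM.
have Mp : M (Om p) by have := nbhs_singleton nM; rewrite scale0r add0r.
move=> /(_ _ Mp)[A [F [oA AOp [dF _] MA gradF]]].
have [gN0 [c gE]] : grad4 F (Om p) != 0 /\
    exists c : R, grad4 F (Om p) = c *: nu (Om p) by apply: gradF; split.
have cN0 : c != 0 by apply: contraNneq gN0 => c0; rewrite gE c0 scale0r.
apply: (mulfI cN0); rewrite mulr0 -dotZl -gE -derive_grad4; last exact: dF.
have dOmE : 'D_d Om p = 'd Om p d by rewrite deriveE.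
have dFp := dF _ AOp.
have dFO : differentiable (F \o Om) p by exact: differentiable_comp.
rewrite dOmE -[LHS]/(('d F (Om p) \o 'd Om p) d) -diff_comp// -deriveE//.
apply: lim_near_cst => //=.
have cOm : (fun h : R => Om (h *: d + p)) @ (0 : R) --> Om p.
  by apply: (cvg_comp _ _ (cvg_line p d)); exact: differentiable_continuous.
have nA : \forall h \near (0 : R), A (Om (h *: d + p)).
  by apply: cOm; exact: open_nbhs_nbhs.
apply: nbhs_dnbhs; move: nA nM; apply: filterS2 => h Ah Mh.
have FO : F (Om (h *: d + p)) = 0.
  by have [] : ([set x | F x = 0] `&` A) (Om (h *: d + p)) by rewrite -MA.
have FOp : F (Om p) = 0.
  by have [] : ([set x | F x = 0] `&` A) (Om p) by rewrite -MA.
by rewrite FO FOp subrr scaler0.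
Qed.

Lemma linear_dependence {R : realType} {N T w : 'rV[R]_4} :
  dotE N N = 1 -> dotE T T = 1 -> dotE N T = 0 -> dotE w T = 0 ->
  ~~ free [:: N; T; w] -> w = dotE w N *: N.
Proof.
move=> NN TT NT wT.
(* Reversing the list makes [free_cons] split off [w] first; as T and N are independent, [w] must
   lie in their span. *)
have -> : free [:: N; T; w] = free [:: w; T; N].
  by apply: perm_free; rewrite -[X in perm_eq X]/(rev [:: w; T; N]) perm_rev.
have N0 : N != 0.
  apply/eqP => N0; move: NN; rewrite N0 /dotE big1 ?(eq_sym 0) => [/eqP|i _].
    by rewrite eq_sym oner_eq0.
  by rewrite mxE mul0r.
have fTN : free [:: T; N].
  rewrite free_cons seq1_free N0 andbT span_seq1; apply/vlineP => -[k TE].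
  move: TT; rewrite {1}TE dotZl NT mulr0 => /eqP.
  by rewrite eq_sym oner_eq0.
rewrite free_cons fTN andbT negbK span_cons span_seq1.
move=> /memv_addP[_ /vlineP[a ->] [_ /vlineP[b ->] wE]].
move: wT; rewrite wE dotDl !dotZl TT NT mulr0 addr0 mulr1 => ->.
by rewrite scale0r add0r dotZl NN mulr1.
Qed.


(** * Derivatives of scalings, square roots and constant inner products *)

Lemma is_derive_scale {R : realType} {V : normedModType R} {n : nat}
    {k : V -> R} {F : V -> 'rV[R]_n} {p d : V} {k' : R} {F' : 'rV[R]_n} :
  is_derive p d k k' -> is_derive p d F F' ->
  is_derive p d (fun q => k q *: F q) (k' *: F p + k p *: F').
Proof.
move=> dk /is_derive_rV dF; apply/is_derive_rV => i.
have -> : (fun q => (k q *: F q) 0 i) = k * (fun q => F q 0 i).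
  by apply/funext => q; rewrite mxE.
by apply: is_derive_eq; rewrite !mxE addrC [_ *: k']mulrC.
Qed.

Lemma is_derive_mul {R : realType} {V : normedModType R} {f g : V -> R}
    {p d : V} {f' g' : R} :
  is_derive p d f f' -> is_derive p d g g' ->
  is_derive p d (fun q => f q * g q) (f' * g p + f p * g').
Proof.
move=> df dg; apply: is_derive_eq (is_deriveM df dg) _.
by rewrite addrC [_ *: f']mulrC.
Qed.

Lemma derivable_sqrt {R : realType} {V : normedModType R} {f : V -> R}
    {p d : V} :
  derivable f p d -> 0 < f p -> derivable (fun q => Num.sqrt (f q)) p d.
Proof.
move=> /derivable1P df fp; apply/derivable1P.
pose g h := f (h *: d + p).
have g0 : 0 < g 0 by rewrite /g scale0r add0r.
by have [] := is_derive1_comp (is_derive1_sqrt g0) (derivableP df).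
Qed.

(** The product rule applied to a constant inner product. It moves a derivative from one factor to
    the other, which is how the frame coefficients below are obtained. *)
Lemma derive_dotE_cst {R : realType} {V : normedModType R} {A : set V}
    {F G : V -> 'rV[R]_4} {p d : V} {c : R} : open A -> A p ->
  derivable F p d -> derivable G p d -> (forall q, A q -> dotE (F q) (G q) = c) ->
  dotE ('D_d F p) (G p) = - dotE (F p) ('D_d G p).
Proof.
move=> oA Ap dF dG FG; apply/eqP; rewrite -addr_eq0; apply/eqP.
have [_ <-] := is_derive_dotE (derivableP dF) (derivableP dG).
have : is_derive p d (fun=> c) (0 : R) by exact: is_derive_cst.
have FG' q : A q -> c = dotE (F q) (G q) by move/FG.
by case/(is_derive_open oA Ap FG').
Qed.

Lemma dot_gt0 {R : realType} {x : 'rV[R]_4} : x != 0 -> 0 < dotE x x.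
Proof.
move=> x0; rewrite lt0r; apply/andP; split; last first.
  by apply: sumr_ge0 => i _; rewrite -expr2 sqr_ge0.
apply: contra x0 => /eqP; rewrite /dotE => xx; apply/eqP/rowP => i.
have xi0 (j : 'I_4) : true -> 0 <= x 0 j * x 0 j by rewrite -expr2 sqr_ge0.
have /eqP : x 0 i * x 0 i = 0 by exact: psumr_eq0P xi0 xx _ _.
by rewrite mulf_eq0 orbb mxE => /eqP.
Qed.

(* Otherwise unification unfolds derivatives down to limits. *)
Opaque derive dotE cross3.

(** * The frame along the soliton surface *)

Section SolitonFrame.
Context {R : realType} {U : set (R * R)} {Om T E D N : R * R -> 'rV[R]_4}.
Context (oU : open U) (COm : class_C 6 U Om) (CN : class_C 2 U N).
Context (bdr : betchov_da_rios U Om) (us : unit_speed U Om).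
Context (frame : ED2_frame_field U Om T E D N).
Context (tau0 : forall p, U p -> tau E N p != 0).
Context (kappa0 : forall p, U p -> kappa T N p != 0).

Local Notation k := (kappa T N).
Local Notation s := (sigma E D).
Local Notation t := (tau E N).
Local Notation u1 := ((1, 0) : R * R).
Local Notation v1 := ((0, 1) : R * R).

Let C1 d : class_C 5 U ('D_d Om). Proof. by have [_ /(_ d)] := COm. Qed.
Let C2 d e : class_C 4 U ('D_e ('D_d Om)).
Proof. by have [_ /(_ e)] := C1 d. Qed.
Let C3 d e f : class_C 3 U ('D_f ('D_e ('D_d Om))).
Proof. by have [_ /(_ f)] := C2 d e. Qed.

Let derivC {W : normedModType R} {j} {F : R * R -> W} {p} d :
  class_C j.+1 U F -> U p -> derivable F p d.
Proof. by move=> CF Up; have [] := class_C1_is_derive d CF Up. Qed.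

Let d_du {p} : U p -> derivable (du Om) p u1.
Proof. exact: derivC (C1 u1). Qed.
Let d_duu {p} : U p -> derivable (du (du Om)) p u1.
Proof. exact: derivC (C2 u1 u1). Qed.
Let d_dv {p} : U p -> derivable (dv Om) p u1.
Proof. exact: derivC (C1 v1). Qed.
Let d_dvv {p} : U p -> derivable (dv Om) p v1.
Proof. exact: derivC (C1 v1). Qed.

Let du_dotE {F G : R * R -> 'rV[R]_4} {p} {c : R} : U p ->
  derivable F p u1 -> derivable G p u1 -> (forall q, U q -> dotE (F q) (G q) = c) ->
  dotE (du F p) (G p) = - dotE (F p) (du G p).
Proof. by move=> Up; exact: derive_dotE_cst. Qed.

Let dv_dotE {F G : R * R -> 'rV[R]_4} {p} {c : R} : U p ->
  derivable F p v1 -> derivable G p v1 -> (forall q, U q -> dotE (F q) (G q) = c) ->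
  dotE (dv F p) (G p) = - dotE (F p) (dv G p).
Proof. by move=> Up; exact: derive_dotE_cst. Qed.

(** Orthogonality to T comes from [normal_tangent] in the direction (1, 0): the points (h + u, v)
    stay in the open set U for small h, and there the curve lies on the hypersurface attached to
    v. *)
Lemma frame_N {p} : U p -> dotE (N p) (N p) = 1 /\ dotE (N p) (T p) = 0.
Proof.
move: p => [u v] Up; have [M [nu [oM MN]]] := ED2_hypersurface frame v.
have [_ nn _] := oM; have [MOm NE] := MN u Up.
rewrite NE nn//; split => //; rewrite (ED2_T frame Up) /du.
apply: (normal_tangent oM); first by have [/(_ _ Up)] := COm.
have nU : \forall h \near (0 : R), U (h *: u1 + (u, v)).
  by apply: (cvg_line (u, v) u1); exact: open_nbhs_nbhs.
move: nU; apply: filterS => h.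
have -> : h *: u1 + (u, v) = (h + u, v).
  apply: injective_projections;
    by rewrite /= ?[_ *: 1]mulr1 ?[_ *: 0]mulr0 ?add0r.
by move=> Uh; have [] := MN _ Uh.
Qed.

Lemma frame_TT {p} : U p -> dotE (T p) (T p) = 1.
Proof. by move=> Up; rewrite (ED2_T frame Up) us. Qed.

Lemma du_T {p} : U p -> is_derive p u1 T (du (du Om) p).
Proof.
move=> Up; apply: (is_derive_open oU Up (f := du Om)).
  by move=> q Uq; rewrite (ED2_T frame Uq).
exact: class_C1_is_derive (C1 u1) Up.
Qed.

(** Unit speed gives 2 <Om_uu, Om_u> = 0, so in the dependence between N, T and Om_uu only the
    N-component survives. *)
Lemma duu_Om {p} : U p -> du (du Om) p = k p *: N p.
Proof.
move=> Up; have [NN NT] := frame_N Up.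
have wT : dotE (du (du Om) p) (T p) = 0.
  have : dotE (du (du Om) p) (du Om p) = - dotE (du Om p) (du (du Om) p).
    exact: du_dotE Up (d_du Up) (d_du Up) us.
  rewrite [in RHS]dotC -(ED2_T frame Up) => /eqP.
  by rewrite -addr_eq0 -mulr2n mulrn_eq0 /= => /eqP.
have [_ dT] := du_T Up; rewrite /kappa /du dT.
exact: linear_dependence NN (frame_TT Up) NT wT (ED2_dependent frame Up).
Qed.

(** E is a Gram-Schmidt vector. The last clause solves its definition for Om_uuu; of the three
    coefficients, only that of E is identified later, in [dv_Om]. *)
Lemma frame_E {p} : U p ->
  [/\ dotE (E p) (E p) = 1, dotE (N p) (E p) = 0, dotE (T p) (E p) = 0 &
   exists r m n, du (du (du Om)) p = r *: E p + m *: N p + n *: T p].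
Proof.
move=> Up; have [NN NT] := frame_N Up; have TT := frame_TT Up.
have TN := NT; rewrite dotC in TN.
have r0 := ED2_residual frame Up; rewrite (ED2_E frame Up).
have rr := dot_gt0 r0.
have l0 : elen (residual Om T N p) != 0 by rewrite gt_eqF// sqrtr_gt0.
have ll : elen (residual Om T N p) ^+ 2 =
    dotE (residual Om T N p) (residual Om T N p) by rewrite sqr_sqrtr// ltW.
split.
- by rewrite dotZl dotZr -ll; field.
- rewrite dotZr /residual -!scaleNr !dotDr !dotZr NN NT (dotC (N p)).
  by rewrite mulr1 mulr0 addr0 subrr mulr0.
- rewrite dotZr /residual -!scaleNr !dotDr !dotZr TT TN (dotC (T p)).
  by rewrite mulr1 mulr0 addr0 subrr mulr0.
exists (elen (residual Om T N p)), (dotE (du (du (du Om)) p) (N p)),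
  (dotE (du (du (du Om)) p) (T p)).
by rewrite scalerA mulfV// scale1r /residual addrAC subrK subrK.
Qed.

(** D has unit length because the Gram matrix of N, T, E is the identity. *)
Lemma frame_D {p} : U p ->
  [/\ dotE (D p) (D p) = 1, dotE (N p) (D p) = 0, dotE (T p) (D p) = 0 &
   dotE (E p) (D p) = 0].
Proof.
move=> Up; have [NN NT] := frame_N Up; have TT := frame_TT Up.
have [EE NE TE _] := frame_E Up; rewrite (ED2_D frame Up).
have [ND TD ED] := dot_cross3_id (N p) (T p) (E p); split => //.
by rewrite cross3_norm NN NT TT EE NE TE; ring.
Qed.

(** The residual is built from differentiable fields, and as it is nonzero its length has a
    differentiable inverse. *)
Lemma derivable_E {p} : U p -> derivable E p u1.
Proof.
move=> Up; have [_ dT] := du_T Up.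
have d3 := class_C1_is_derive u1 (C3 u1 u1 u1) Up.
have dN := class_C1_is_derive u1 CN Up.
have dr : derivable (residual Om T N) p u1.
  have [+ _] := is_deriveB
    (is_deriveB d3 (is_derive_scale (is_derive_dotE d3 dN) dN))
    (is_derive_scale (is_derive_dotE d3 (du_T Up)) (du_T Up)).
  by [].
have rr := dot_gt0 (ED2_residual frame Up).
have l0 : elen (residual Om T N p) != 0 by rewrite gt_eqF// sqrtr_gt0.
have dl : derivable (fun q => elen (residual Om T N q)) p u1.
  apply: derivable_sqrt => //.
  by have [] := is_derive_dotE (derivableP dr) (derivableP dr).
have di : derivable (fun q => (elen (residual Om T N q))^-1) p u1.
  exact: (derivableV (f := fun q => elen (residual Om T N q))).
have dE := is_derive_scale (derivableP di) (derivableP dr).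
have EE q : U q -> (elen (residual Om T N q))^-1 *: residual Om T N q = E q.
  by move=> Uq; rewrite (ED2_E frame Uq).
by case: (is_derive_open oU Up EE dE).
Qed.

Lemma derivable_D {p} : U p -> derivable D p u1.
Proof.
move=> Up; have [dT _] := du_T Up.
have dD := derivableP (derivable_cross3 (derivC u1 CN Up) dT (derivable_E Up)).
have DE q : U q -> cross3 (N q) (T q) (E q) = D q.
  by move=> Uq; rewrite (ED2_D frame Uq).
by case: (is_derive_open oU Up DE dD).
Qed.

Lemma kappaE {p} : U p -> k p = dotE (du (du Om) p) (N p).
Proof. by move=> Up; have [_ dT] := du_T Up; rewrite /kappa {1}/du dT. Qed.

Lemma is_derive_kappa {p} d : U p ->
  is_derive p d k (dotE ('D_d (du (du Om)) p) (N p) +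
                   dotE (du (du Om) p) ('D_d N p)).
Proof.
move=> Up.
apply: (is_derive_open oU Up (f := fun q => dotE (du (du Om) q) (N q))).
  by move=> q Uq; rewrite kappaE.
apply: is_derive_dotE; first exact: class_C1_is_derive (C2 u1 u1) Up.
exact: class_C1_is_derive CN Up.
Qed.

(** From kappa = <Om_uu, N> one gets kappa_u = <Om_uuu, N> + <Om_uu, N_u>, where every factor can be
    differentiated again. *)
Lemma derivable_du_kappa {p} : U p -> derivable (du k) p u1.
Proof.
move=> Up.
have d2 := class_C1_is_derive u1 (C2 u1 u1) Up.
have d3 := class_C1_is_derive u1 (C3 u1 u1 u1) Up.
have dN := class_C1_is_derive u1 CN Up.
have CN1 : class_C 1 U ('D_u1 N) by have [_ /(_ u1)] := CN.
have dN1 := class_C1_is_derive u1 CN1 Up.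
have := is_deriveD (is_derive_dotE d3 dN) (is_derive_dotE d2 dN1).
have E1 q : U q -> dotE ('D_u1 (du (du Om)) q) (N q) +
    dotE (du (du Om) q) ('D_u1 N q) = du k q.
  by move=> Uq; have [_ <-] := is_derive_kappa u1 Uq.
by move=> /(is_derive_open oU Up E1)[].
Qed.

(** * The velocity field W D, its derivatives and the Gaussian torsion *)

Local Notation W := (soliton_W T E N).

Lemma dot_duuu_E {p} : U p -> dotE (du (du (du Om)) p) (E p) = - (k p * t p).
Proof.
move=> Up.
have EE q : U q -> dotE (du (du Om) q) (E q) = 0.
  by move=> Uq; have [_ NEq _ _] := frame_E Uq; rewrite duu_Om// dotZl NEq mulr0.
rewrite (du_dotE Up (d_duu Up) (derivable_E Up) EE).
by rewrite duu_Om// dotZl (dotC (N p)).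
Qed.

(** The E-component of Om_uuu is -kappa tau, so [cross3_combination] yields the factor -kappa
    (-kappa tau) = W. *)
Lemma dv_Om {p} : U p -> dv Om p = W p *: D p.
Proof.
move=> Up; have [EE NE TE [r [m [n wE]]]] := frame_E Up.
have rE : r = - (k p * t p).
  by rewrite -dot_duuu_E// wE !dotDl !dotZl EE NE TE; ring.
rewrite bdr// -(ED2_T frame Up) wE duu_Om// cross3_combination -(ED2_D frame Up).
by rewrite rE /soliton_W; congr (_ *: _); ring.
Qed.

Lemma dot_du_D {p} : U p ->
  [/\ dotE (N p) (du D p) = 0, dotE (T p) (du D p) = 0,
      dotE (D p) (du D p) = 0 & dotE (E p) (du D p) = - s p].
Proof.
move=> Up; have [DD ND TD ED] := frame_D Up; have dD := derivable_D Up.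
have [EE _ _ [r [m [n wE]]]] := frame_E Up.
have d1 := d_du Up; have d2 := d_duu Up.
have D2 q : U q -> dotE (du (du Om) q) (D q) = 0.
  by move=> Uq; have [_ NDq _ _] := frame_D Uq; rewrite duu_Om// dotZl NDq mulr0.
have D1 q : U q -> dotE (du Om q) (D q) = 0.
  by move=> Uq; have [_ _ TDq _] := frame_D Uq; rewrite -(ED2_T frame Uq).
have DD1 q : U q -> dotE (D q) (D q) = 1 by move=> Uq; have [] := frame_D Uq.
split.
(* Differentiating <Om_uu, D> = 0 gives kappa <N, D_u> = -<Om_uuu, D> = 0, and kappa is
   cancelled. *)
- have := du_dotE Up d2 dD D2.
  rewrite wE !dotDl !dotZl ED ND TD duu_Om// dotZl.
  rewrite !mulr0 !addr0 => /eqP.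
  by rewrite eq_sym oppr_eq0 mulf_eq0 (negPf (kappa0 _ Up)) => /eqP.
- have := du_dotE Up d1 dD D1.
  rewrite duu_Om// dotZl ND mulr0 -(ED2_T frame Up).
  by move=> /eqP; rewrite eq_sym oppr_eq0 => /eqP.
- have := du_dotE Up dD dD DD1.
  rewrite dotC => /eqP.
  by rewrite -addr_eq0 -mulr2n mulrn_eq0 /= => /eqP.
have ED1 q : U q -> dotE (E q) (D q) = 0 by move=> Uq; have [] := frame_D Uq.
by rewrite /sigma (du_dotE Up (derivable_E Up) dD ED1) opprK.
Qed.

(** This is D_u = -sigma E tested against an arbitrary vector, by expansion in the frame. *)
Lemma dot_du_Dr {p} x : U p -> dotE x (du D p) = - s p * dotE x (E p).
Proof.
move=> Up; have [NN NT] := frame_N Up; have TT := frame_TT Up.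
have [EE NE TE _] := frame_E Up; have [DD ND TD ED] := frame_D Up.
have [ND' TD' DD' ED'] := dot_du_D Up.
rewrite (parseval4 x (du D p) NN TT EE DD NT NE ND TE TD ED).
rewrite !(dotC (du D p)) ND' TD' DD' ED'; ring.
Qed.

Let is_derive_D {p} : U p -> is_derive p u1 D (du D p).
Proof. by move=> Up; apply: derivableP; exact: derivable_D. Qed.
Let is_derive_dv_Om {p} : U p -> is_derive p u1 (dv Om) (du (dv Om) p).
Proof. by move=> Up; apply: derivableP; exact: d_dv. Qed.
Let is_derive_dudv_Om {p} : U p ->
  is_derive p u1 (du (dv Om)) (du (du (dv Om)) p).
Proof. exact: class_C1_is_derive (C2 v1 u1). Qed.

(* As D_u is orthogonal to D, the derivative of W = <Om_v, D> does not involve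
   D_u; so W is twice differentiable although D is differentiated only once. *)
Lemma is_derive_W {p} : U p -> is_derive p u1 W (dotE (du (dv Om) p) (D p)).
Proof.
move=> Up; have [DD _ _ _] := frame_D Up; have [_ _ DD' _] := dot_du_D Up.
have WE q : U q -> dotE (dv Om q) (D q) = W q.
  by move=> Uq; have [DDq _ _ _] := frame_D Uq; rewrite dv_Om// dotZl DDq mulr1.
have := is_derive_dotE (is_derive_dv_Om Up) (is_derive_D Up).
move=> /(is_derive_open oU Up WE) dW; apply: is_derive_eq dW _.
by rewrite dv_Om// dotZl DD' mulr0 addr0.
Qed.

(** Since Om_v = W D is orthogonal to E and N, the derivative moves onto these: -W <D, E_u> = -W
    sigma and -W <D, N_u> = W <N, D_u> = 0. *)
Lemma dot_dudv_Om {p} : U p ->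
  dotE (du (dv Om) p) (E p) = - (W p * s p) /\ dotE (du (dv Om) p) (N p) = 0.
Proof.
move=> Up; have [ND' _ _ _] := dot_du_D Up; have d1 := d_dv Up.
have fE q : U q -> dotE (dv Om q) (E q) = 0.
  by move=> Uq; have [_ _ _ ED] := frame_D Uq; rewrite dv_Om// dotZl dotC ED mulr0.
have fN q : U q -> dotE (dv Om q) (N q) = 0.
  by move=> Uq; have [_ ND _ _] := frame_D Uq; rewrite dv_Om// dotZl dotC ND mulr0.
have ND q : U q -> dotE (N q) (D q) = 0 by move=> Uq; have [] := frame_D Uq.
rewrite (du_dotE Up d1 (derivable_E Up) fE) (du_dotE Up d1 (derivC u1 CN Up) fN).
rewrite dv_Om// !dotZl (dotC (D p)) (dotC (D p)).
rewrite (du_dotE Up (derivC u1 CN Up) (derivable_D Up) ND) ND'.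
by rewrite oppr0 mulr0 oppr0.
Qed.

(** In the derivative of W_u = <Om_vu, D>, the term <Om_vu, D_u> = -sigma <Om_vu, E> equals sigma^2
    W. *)
Lemma is_derive_du_W {p} : U p -> is_derive p u1 (du W)
  (dotE (du (du (dv Om)) p) (D p) + s p ^+ 2 * W p).
Proof.
move=> Up.
have WE q : U q -> dotE (du (dv Om) q) (D q) = du W q.
  by move=> Uq; have [_ <-] := is_derive_W Uq.
have := is_derive_dotE (is_derive_dudv_Om Up) (is_derive_D Up).
move=> /(is_derive_open oU Up WE) dW; apply: is_derive_eq dW _.
have E1 : dotE (du (dv Om) p) (du D p) = s p ^+ 2 * W p.
  apply: (etrans (dot_du_Dr _ Up)).
  have [E2 _] := dot_dudv_Om Up.
  by rewrite E2 mulrNN mulrCA -expr2 (mulrC (W p)).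
exact: (congr1 _ E1).
Qed.

Lemma dvdu_Om {p} : U p -> dv (du Om) p = du (dv Om) p.
Proof. by move=> Up; apply: class_C_du_dv oU Up _; do 4!apply: class_CW. Qed.

(** The v-derivative passes one u-derivative at a time. The second exchange happens under a
    u-derivative, so it is used as an equality on all of U. *)
Lemma dvduu_Om {p} : U p -> dv (du (du Om)) p = du (du (dv Om)) p.
Proof.
move=> Up; rewrite (class_C_du_dv oU Up); last first.
  by do 3!apply: class_CW; exact: C1.
have E1 q : U q -> dv (du Om) q = du (dv Om) q by exact: dvdu_Om.
have [_ E2] := is_derive_open oU Up E1 (class_C1_is_derive u1 (C2 u1 v1) Up).
exact: esym E2.
Qed.

(** In the v-derivative of kappa N = Om_uu, pairing with D removes the term in kappa_v, and <Om_uuv,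
    D> = <Om_vuu, D> is read off from W_uu. *)
Lemma dot_dv_N {p} : U p ->
  k p * dotE (dv N p) (D p) = du (du W) p - s p ^+ 2 * W p.
Proof.
move=> Up; have [_ ND _ _] := frame_D Up.
have [dk _] := is_derive_kappa v1 Up.
have dN := class_C1_is_derive v1 CN Up.
have kN q : U q -> k q *: N q = du (du Om) q by move=> Uq; rewrite duu_Om.
have [_ E1] := is_derive_open oU Up kN (is_derive_scale (derivableP dk) dN).
have [_ WE] := is_derive_du_W Up.
have -> : du (du W) p = 'D_u1 (du W) p by [].
rewrite WE addrK -dvduu_Om// {2}/dv E1 dotDl !dotZl ND mulr0 add0r //.
Qed.

Lemma dot_dvv_Om {p} : U p -> k p * dotE (dv (dv Om) p) (N p) =
  - W p * (du (du W) p - s p ^+ 2 * W p).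
Proof.
move=> Up; rewrite -dot_dv_N//.
have fN q : U q -> dotE (dv Om q) (N q) = 0.
  by move=> Uq; have [_ ND _ _] := frame_D Uq; rewrite dv_Om// dotZl dotC ND mulr0.
rewrite (dv_dotE Up (d_dvv Up) (derivC v1 CN Up) fN).
by rewrite dv_Om// dotZl (dotC (D p)); ring.
Qed.

Lemma soliton_W_neq0 {p} : U p -> W p != 0.
Proof.
by move=> Up; apply: mulf_neq0 (expf_neq0 _ (kappa0 _ Up)) (tau0 _ Up).
Qed.

(** The factor kappa is present because <Om_vv, N> is known only through its product with kappa; the
    factor W clears the remaining denominator. *)
Lemma torsionE {p} : U p -> k p * gaussian_torsion Om E N W p * W p =
  s p * ((du (du W) p - s p ^+ 2 * W p) + k p ^+ 2 * W p).
Proof.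
(* Here [c] is kappa, [r] is sigma, [w] is W and [x] is W_uu - sigma^2 W. The value [e1] of <Om_vv,
   E> meets only the zero factors [b2] and [g12]. *)
have alg (g11 g12 g22 a1 a2 b1 b2 e1 e2 w c r x : R) : w != 0 ->
    g11 = 1 -> g12 = 0 -> g22 = w ^+ 2 -> a1 = 0 -> a2 = c ->
    b1 = - (w * r) -> b2 = 0 -> c * e2 = - w * x ->
    c * ((g11 * (b1 * e2 - b2 * e1) - g12 * (a1 * e2 - a2 * e1)
          + g22 * (a1 * b2 - a2 * b1)) / w ^+ 3) * w = r * (x + c ^+ 2 * w).
  move=> w0 -> -> -> -> -> -> -> ce.
  transitivity (r * (- (c * e2) + c ^+ 2 * w ^+ 2) / w); first by field.
  by rewrite ce; field.
move=> Up; have [NN NT] := frame_N Up.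
have [_ NE _ _] := frame_E Up; have [DD _ TD _] := frame_D Up.
have [b1 b2] := dot_dudv_Om Up; have c22 := dot_dvv_Om Up.
have g12 : dotE (du Om p) (dv Om p) = 0.
  by rewrite -(ED2_T frame Up) dv_Om// dotZr TD mulr0.
have g22 : dotE (dv Om p) (dv Om p) = W p ^+ 2.
  by rewrite dv_Om// dotZl dotZr DD mulr1.
have a1 : dotE (du (du Om) p) (E p) = 0 by rewrite duu_Om// dotZl NE mulr0.
have a2 : dotE (du (du Om) p) (N p) = k p by rewrite duu_Om// dotZl NN mulr1.
rewrite -(dvdu_Om Up) in b1 b2.
exact: alg (soliton_W_neq0 Up) (us _ Up) g12 g22 a1 a2 b1 b2 c22.
Qed.

(** * Differentiability of tau and the expansion of W_uu *)

Let dk {p} : U p -> is_derive p u1 k (du k p).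
Proof. by move=> Up; have [] := is_derive_kappa u1 Up. Qed.
Let dkk {p} : U p -> is_derive p u1 (du k) (du (du k) p).
Proof. by move=> Up; apply: derivableP; exact: derivable_du_kappa. Qed.

Let div_kappa2 {f : R * R -> R} {p} : U p ->
  derivable f p u1 -> derivable (fun q => f q / k q / k q) p u1.
Proof.
move=> Up df; have [dkp _] := dk Up.
pose V q := (k q)^-1.
have dV : derivable V p u1 by exact: derivableV (kappa0 _ Up) dkp.
exact: derivableM (derivableM df dV) dV.
Qed.

(** Differentiability passes from W to tau = W / kappa^2, which avoids a second derivative of E. *)
Lemma derivable_tau {p} : U p -> derivable t p u1.
Proof.
move=> Up; have [dW _] := is_derive_W Up.
have tE q : U q -> W q / k q / k q = t q.
  by move=> /kappa0 k0; rewrite /soliton_W; field.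
by case: (is_derive_open oU Up tE (derivableP (div_kappa2 Up dW))).
Qed.

Let dt {p} : U p -> is_derive p u1 t (du t p).
Proof. by move=> Up; apply: derivableP; exact: derivable_tau. Qed.

Lemma du_W {p} : U p ->
  du W p = k p ^+ 2 * du t p + 2 * (k p * du k p * t p).
Proof.
move=> Up; have WE q : U q -> k q * k q * t q = W q.
  by rewrite /soliton_W expr2.
have [_ E1] := is_derive_open oU Up WE
  (is_derive_mul (is_derive_mul (dk Up) (dk Up)) (dt Up)).
have alg (a a' b b' : R) :
    (a' * a + a * a') * b + a * a * b' = a ^+ 2 * b' + 2 * (a * a' * b) by ring.
exact: etrans E1 (alg _ _ _ _).
Qed.

(** Solving [du_W] for tau_u leaves only W_u, kappa, kappa_u and tau, all differentiable;
    differentiating <E_u, N> twice would call for third derivatives of N, which is of class C^2. *)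
Lemma derivable_du_tau {p} : U p -> derivable (du t) p u1.
Proof.
move=> Up; have [dt1 _] := dt Up; have [dk1 _] := dk Up; have [dk2 _] := dkk Up.
have [dW _] := is_derive_du_W Up.
have dkkt := derivableZ (k := 2) (derivableM (derivableM dk1 dk2) dt1).
have tE q : U q ->
    (du W q - 2 * (k q * du k q * t q)) / k q / k q = du t q.
  have alg (a b c : R) : a != 0 -> (a ^+ 2 * b + c - c) / a / a = b.
    by move=> a0; field.
  by move=> Uq; rewrite du_W//; exact: alg (kappa0 _ Uq).
have := div_kappa2 Up (derivableB dW dkkt).
by move=> /derivableP /(is_derive_open oU Up tE)[].
Qed.

Lemma duu_W {p} : U p ->
  du (du W) p = 2 * (du k p ^+ 2 + k p * du (du k) p) * t p
    + 4 * k p * du k p * du t p + k p ^+ 2 * du (du t) p.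
Proof.
move=> Up; have d1 := dk Up; have d3 := dt Up.
have d4 := derivableP (derivable_du_tau Up).
(* The factor 2 is written as a sum, so that only sum and product rules are needed. *)
have WE q : U q ->
    k q * k q * du t q + (k q * du k q * t q + k q * du k q * t q) = du W q.
  by move=> Uq; rewrite du_W// expr2 mulr_natl mulr2n.
have kkt := is_derive_mul (is_derive_mul d1 (dkk Up)) d3.
have [_ E1] := is_derive_open oU Up WE
  (is_deriveD (is_derive_mul (is_derive_mul d1 d1) d4) (is_deriveD kkt kkt)).
have alg (a a' a'' b b' b'' : R) : (a' * a + a * a') * b' + a * a * b'' +
    (((a' * a' + a * a'') * b + a * a' * b') +
     ((a' * a' + a * a'') * b + a * a' * b')) =
    2 * (a' ^+ 2 + a * a'') * b + 4 * a * a' * b' + a ^+ 2 * b'' by ring.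
exact: etrans E1 (alg _ _ _ _ _ _).
Qed.

(** Compared with [dot_dv_N], this says a34 = -<N_v, D>, which is <D_v, N>: the entry in row D and
    column N of the v-derivative matrix of the frame ordered T, E, D, N. *)
Lemma a34E {p} : U p ->
  k p * a34 k s t p = - (du (du W) p - s p ^+ 2 * W p).
Proof.
move=> Up; rewrite duu_W// /a34 /soliton_W.
have alg (a a' a'' b b' b'' c : R) : a != 0 ->
    a * (a^-1 * ((a * b * c ^+ 2 - 4 * a' * b' - a * b'') * a
                 - 2 * (a' ^+ 2 + a * a'') * b)) =
    - (2 * (a' ^+ 2 + a * a'') * b + 4 * a * a' * b' + a ^+ 2 * b''
       - c ^+ 2 * (a ^+ 2 * b)).
  by move=> a0; field.
exact: alg (kappa0 _ Up).
Qed.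

(** Combining [torsionE] and [a34E] gives kappa K_N W = kappa sigma (kappa^3 tau - a34), where kappa
    and W are nonzero. As sigma may vanish, it stays on both sides. *)
Lemma semi_umbilic_atE {p} : U p ->
  semi_umbilic_at Om T E N p <->
  a34 k s t p * s p = k p ^+ 3 * t p * s p.
Proof.
(* The variables stand for K_N, a34, kappa, tau, sigma and W_uu - sigma^2 W, in this order. *)
have alg (g a b c r x : R) : b != 0 -> b ^+ 2 * c != 0 ->
    b * g * (b ^+ 2 * c) = r * (x + b ^+ 2 * (b ^+ 2 * c)) -> b * a = - x ->
    g = 0 <-> a * r = b ^+ 3 * c * r.
  move=> b0 w0 K A.
  have {}A : x = - (b * a) by rewrite A opprK.
  rewrite {}A in K; split=> [g0|ar].
    rewrite g0 mulr0 mul0r in K.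
    apply: (mulfI b0); apply/eqP; rewrite -subr_eq0; apply/eqP.
    by rewrite -[RHS]oppr0 K; ring.
  apply: (mulfI b0); apply: (mulIf w0); rewrite K mulr0 mul0r.
  by rewrite mulrDr mulrN mulrCA [r * a]mulrC ar; ring.
move=> Up; exact: alg (kappa0 _ Up) (soliton_W_neq0 Up) (torsionE Up) (a34E Up).
Qed.

End SolitonFrame.

Theorem theorem8 (R : realType) (U : set (R * R))
    (Om T E D N : R * R -> 'rV[R]_4) :
  open U ->
  class_C 6 U Om ->
  class_C 2 U N ->
  betchov_da_rios U Om ->
  unit_speed U Om ->
  ED2_frame_field U Om T E D N ->
  (forall p, U p -> kappa T N p != 0) ->
  (forall p, U p -> tau E N p != 0) ->
  semi_umbilic U Om T E N <->
  (forall p, U p ->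
     a34 (kappa T N) (sigma E D) (tau E N) p * sigma E D p
     = kappa T N p ^+ 3 * tau E N p * sigma E D p).
Proof.
move=> oU COm CN bdr us frame k0 t0.
have H p := @semi_umbilic_atE _ _ _ _ _ _ _ oU COm CN bdr us frame t0 k0 p.
by split=> S p Up; have := S p Up; have [] := H p Up; auto.
Qed.
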